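(* Consider the two-player, two-item all-pay auction with budgets described in the context, with $B_1\neq B_2$; let $s=\arg\max_{i\in\{1,2\}}B_i$, let $w$ be the other player, and let $L_j=\min\{B_1,B_2,v_{1j},v_{2j}\}$ for $j\in\{1,2\}$. Suppose $v_{s1}=L_1$ and $v_{s2}=L_2$. Let $T_1=L_1-v_{w1}+\frac{L_2}{v_{w2}}v_{w1}$ and $T_2=L_2-v_{w2}+\frac{L_1}{v_{w1}}v_{w2}$. Define $$f_s(x_{s1},x_{s2})=\begin{cases}\dfrac{\frac{L_1}{v_{w1}}+\frac{L_2}{v_{w2}}-1}{\sqrt{T_1^2+T_2^2}}, & x_{s1}\in[0,T_1),\ x_{s2}\in[0,T_2),\ x_{s2}=-\frac{T_2}{T_1}x_{s1}+T_2;\\ \frac{1}{v_{w1}}, & x_{s1}\in[T_1,L_1],\ x_{s2}=0;\\ \frac{1}{v_{w2}}, & x_{s1}=0,\ x_{s2}\in[T_2,L_2],\end{cases}$$ and $$f_w(x_{w1},x_{w2})=\frac{1}{\sqrt{L_1^2+L_2^2}},\quad x_{w1}\in[0,L_1],\ x_{w2}\in[0,L_2],\ x_{w2}=-\frac{L_2}{L_1}x_{w1}+L_2.$$ Then $(f_s,f_w)$ forms a Nash equilibrium.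
   Context: Multi-item all-pay auction with budgets. Two players $i\in\{1,2\}$ ($-i$ is the opponent of $i$) and $n$ items $j\in\{1,\dots,n\}$. Player $i$ has budget $B_i\ge0$ and values item $j$ at $v_{ij}>0$. A pure strategy of player $i$ is a vector $(x_{i1},\dots,x_{in})$ with all $x_{ij}\ge0$ and $\sum_j x_{ij}\le B_i$; a mixed strategy is a probability distribution over this set. On each item $j$ the higher bid wins the item. Tie-breaking on item $j$: if $x_{1j}=x_{2j}=\min\{B_1,B_2,v_{1j},v_{2j}\}$ and $\min\{B_i,v_{ij}\}>\min\{B_{-i},v_{-ij}\}$ for some $i$, then player $i$ wins item $j$; in all other ties each player wins item $j$ with probability $\frac12$. Player $i$'s utility on item $j$ is $v_{ij}-x_{ij}$ if he wins it and $-x_{ij}$ otherwise, and his total utility is the sum over items. A Nash equilibrium is a pair of mixed strategies in which each player's strategy maximizes his expected total utility against the other's, over all mixed strategies satisfying his budget constraint. Here $n=2$. Mixed strategies are specified by densities supported on finitely many line segments in the plane; such a density is with respect to arc length (one-dimensional length measure) on the indicated segment, so the probability of a segment piece is the density times its length.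
   Formalization: The formal theorem adds the assumption L_1/v_{w1} + L_2/v_{w2} ≥ 1 (equivalently T_1, T_2 ≥ 0); without it f_s is not a probability distribution (e.g. L_1=L_2=1, v_{w1}=v_{w2}=10 gives total mass 1.8 and negative bids). *)

(* Defs.v *)
From HB Require Import structures.
From mathcomp Require Import all_boot all_order all_algebra.
From mathcomp Require Import all_classical all_reals all_analysis.
Set Implicit Arguments. Unset Strict Implicit. Unset Printing Implicit Defensive.
Import Order.TTheory GRing.Theory Num.Theory.
Local Open Scope classical_set_scope.
Local Open Scope ring_scope.

Section AllPay.
Variable R : realType.

(* Players and items are both indexed by 'I_2: index 0 stands for player/item 1,
   index 1 for player/item 2.  A pure strategy (bid vector) is a point
   (x_1, x_2) : R * R, where x.1 is the bid on item 1 and x.2 the bid on item 2. *)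

Definition opp (i : 'I_2) : 'I_2 := if i == ord0 then 1%R else ord0.

Definition bid (x : R * R) (j : 'I_2) : R := if j == ord0 then x.1 else x.2.

Definition Lmin (B : 'I_2 -> R) (v : 'I_2 -> 'I_2 -> R) (j : 'I_2) : R :=
  Num.min (Num.min (B ord0) (B 1%R)) (Num.min (v ord0 j) (v 1%R j)).

Definition budget (B : 'I_2 -> R) (i : 'I_2) : set (R * R) :=
  [set x | 0 <= x.1 /\ 0 <= x.2 /\ x.1 + x.2 <= B i].

Definition win_prob (B : 'I_2 -> R) (v : 'I_2 -> 'I_2 -> R) (i j : 'I_2)
    (a b : R) : R :=
  if b < a then 1
  else if a < b then 0
  else
    if (a == Lmin B v j) && (Num.min (B (opp i)) (v (opp i) j) < Num.min (B i) (v i j))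
    then 1
    else if (a == Lmin B v j) && (Num.min (B i) (v i j) < Num.min (B (opp i)) (v (opp i) j))
    then 0
    else 1 / 2.

Definition util (B : 'I_2 -> R) (v : 'I_2 -> 'I_2 -> R) (i : 'I_2)
    (xi xo : R * R) : R :=
  \sum_(j < 2) (win_prob B v i j (bid xi j) (bid xo j) * v i j - bid xi j).

Definition exp_util (B : 'I_2 -> R) (v : 'I_2 -> 'I_2 -> R) (i : 'I_2)
    (Pi Po : probability (R * R)%type R) : \bar R :=
  (\int[Pi]_xi (\int[Po]_xo (util B v i xi xo)%:E))%E.

Definition mixed_strategy (B : 'I_2 -> R) (i : 'I_2)
    (P : probability (R * R)%type R) : Prop :=
  P (budget B i) = 1%E.

Definition represents (mu : set (R * R) -> \bar R)
    (P : probability (R * R)%type R) : Prop :=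
  forall A, measurable A -> P A = mu A.

Definition nash_equilibrium (B : 'I_2 -> R) (v : 'I_2 -> 'I_2 -> R)
    (sigma : 'I_2 -> set (R * R) -> \bar R) : Prop :=
  exists P : 'I_2 -> probability (R * R)%type R,
    (forall i, represents (sigma i) (P i)) /\
    (forall i, mixed_strategy B i (P i)) /\
    (forall i (Q : probability (R * R)%type R), mixed_strategy B i Q ->
       (exp_util B v i Q (P (opp i)) <= exp_util B v i (P i) (P (opp i)))%E).

(* One-dimensional length (arc-length) measure of a set E contained in the
   segment [p, q] of the plane: |q - p| times the Lebesgue measure of the
   parameters t in [0,1] with p + t (q - p) in E. *)
Definition seg_length (p q : R * R) (E : set (R * R)) : \bar R :=
  ((Num.sqrt ((q.1 - p.1) ^+ 2 + (q.2 - p.2) ^+ 2))%:E *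
   lebesgue_measure [set t : R | (0 <= t <= 1)%R /\
                        E ((p.1 + t * (q.1 - p.1))%R, (p.2 + t * (q.2 - p.2))%R)])%E.

(* The strategy f_s of the theorem, given L1, L2, v_w1, v_w2, as a set function
   (density w.r.t. arc length on the three segment pieces). *)
Definition f_s (L1 L2 vw1 vw2 : R) (A : set (R * R)) : \bar R :=
  let T1 := L1 - vw1 + L2 / vw2 * vw1 in
  let T2 := L2 - vw2 + L1 / vw1 * vw2 in
  let S1 := [set x : R * R | 0 <= x.1 < T1 /\ 0 <= x.2 < T2 /\
                              x.2 = - (T2 / T1) * x.1 + T2] in
  let S2 := [set x : R * R | T1 <= x.1 <= L1 /\ x.2 = 0] in
  let S3 := [set x : R * R | x.1 = 0 /\ T2 <= x.2 <= L2] in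
  (((L1 / vw1 + L2 / vw2 - 1) / Num.sqrt (T1 ^+ 2 + T2 ^+ 2))%:E
      * seg_length (0%R, T2) (T1, 0%R) (A `&` S1)
   + (1 / vw1)%:E * seg_length (T1, 0%R) (L1, 0%R) (A `&` S2)
   + (1 / vw2)%:E * seg_length (0%R, T2) (0%R, L2) (A `&` S3))%E.

Definition f_w (L1 L2 : R) (A : set (R * R)) : \bar R :=
  let S := [set x : R * R | 0 <= x.1 <= L1 /\ 0 <= x.2 <= L2 /\
                             x.2 = - (L2 / L1) * x.1 + L2] in
  ((1 / Num.sqrt (L1 ^+ 2 + L2 ^+ 2))%:E * seg_length (0%R, L2) (L1, 0%R) (A `&` S))%E.

End AllPay.

(* Main.v *)
(** The uniform law on the segment from (0, L2) to (L1, 0) has uniform marginals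
    on [0, L_j], so a bid a <= L_j of player s wins item j with probability
    a / L_j and his utility v_sj * a / L_j - a = 0 is never exceeded.  The
    marginal of f_s on item j has an atom of mass 1 - L_j / v_wj at 0 and density
    1 / v_wj on [0, L_j], so every bid of player w in (0, L_j] yields
    v_wj - L_j, which no other bid exceeds.  Since utilities add up over items,
    only the marginals matter, and the support of each strategy is almost surely
    contained in the set of bids attaining the bound. *)
Require Import Defs.
From HB Require Import structures.
From mathcomp Require Import all_boot all_order all_algebra.
From mathcomp Require Import all_classical all_reals all_analysis.
From mathcomp Require Import measurable_realfun ring lra.
Import Order.TTheory GRing.Theory Num.Theory.
Local Open Scope classical_set_scope.
Local Open Scope ring_scope.

(** * The two indices, and events of probability one *)

Lemma forall_I2 (P : 'I_2 -> Prop) : P ord0 -> P 1%R -> forall j, P j.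
Proof.
by move=> P0 P1 [[|[|//]] h]; [move: P0|move: P1];
  congr (P _); exact: val_inj.
Qed.

Lemma oppP (i k : 'I_2) : k != i -> Defs.opp i = k.
Proof. by move: i k; apply: forall_I2; apply: forall_I2. Qed.

Lemma integral_cst_prob1 {d} {T : measurableType d} {R : realType}
    (P : probability T R) (D : set T) (c : R) :
  measurable D -> P D = 1%E -> (\int[P]_(x in D) c%:E = c%:E)%E.
Proof. by move=> mD PD; rewrite integral_cst// [X in (_ * X)%E]PD mule1. Qed.

Lemma prob1_setC {d} {T : measurableType d} {R : realType}
    (P : probability T R) (A : set T) :
  measurable A -> P A = 1%E -> P (~` A) = 0%E.
Proof. by move=> mA PA; rewrite probability_setC// PA subee. Qed.

Lemma prob1_setI {d} {T : measurableType d} {R : realType}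
    (P : probability T R) (A A' : set T) : measurable A -> measurable A' ->
  P A = 1%E -> P A' = 1%E -> P (A `&` A') = 1%E.
Proof.
move=> mA mA' PA PA'; have mI := measurableI _ _ mA mA'.
rewrite -[A `&` A']setCK probability_setC; last exact: measurableC.
suff -> : P (~` (A `&` A')) = 0%E by rewrite sube0.
by rewrite setCI; apply: null_set_setU;
  [exact: measurableC|exact: measurableC|exact: prob1_setC|exact: prob1_setC].
Qed.

(** * Payoff of a pure bid against a mixed strategy *)

Section BestResponse.
Context {R : realType}.
Variables (B : 'I_2 -> R) (v : 'I_2 -> 'I_2 -> R) (i : 'I_2).
Local Notation win := (win_prob B v i).

Lemma measurable_bid (j : 'I_2) :
  measurable_fun [set: (R * R)%type] (fun x => bid x j).
Proof. by rewrite /bid; case: (j == ord0); [exact: measurable_fst|exact: measurable_snd]. Qed.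

Lemma measurable_bid_lt (j : 'I_2) (a : R) :
  measurable [set y : R * R | bid y j < a].
Proof.
rewrite -[X in measurable X]setTI.
have /(_ measurableT [set true]) := measurable_fun_ltr (measurable_bid j)
  (@measurable_cst _ _ _ _ setT a).
exact.
Qed.

Lemma measurable_bid_le (j : 'I_2) (a : R) :
  measurable [set y : R * R | bid y j <= a].
Proof.
rewrite -[X in measurable X]setTI.
have /(_ measurableT [set true]) := measurable_fun_ler (measurable_bid j)
  (@measurable_cst _ _ _ _ setT a).
exact.
Qed.

Lemma win_prob_ge0 j a b : 0 <= win j a b.
Proof. by rewrite /win_prob; do 4?case: ifP => // _; lra. Qed.

(** Every tie outcome is a value in [0, 1], so the winning probability sits between the indicators
    of [b < a] and [b <= a]. Booleans are cast to numbers so that integration turns these bounds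
    into distribution functions. *)
Lemma win_prob_le j a b : win j a b <= (b <= a)%R%:R.
Proof. rewrite /win_prob; case: ltgtP => //= _; do 2?case: ifP => // _; rewrite ?mulr1n ?mulr0n; lra. Qed.

Lemma win_prob_ge j a b : (b < a)%R%:R <= win j a b.
Proof. by rewrite /win_prob; case: ltgtP => //= _; do 2?case: ifP => // _; rewrite ?mulr1n ?mulr0n; lra. Qed.

Lemma win_prob_le1 j a b : win j a b <= 1.
Proof. by apply: (le_trans (win_prob_le j a b)); case: (b <= a). Qed.

Lemma measurable_win_prob j : measurable_fun [set: ((R * R) * (R * R))%type]
  (fun z => win j (bid z.1 j) (bid z.2 j)).
Proof.
have m1 : measurable_fun setT (fun z : (R * R) * (R * R) => bid z.1 j).
  exact: (measurableT_comp (measurable_bid j)).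
have m2 : measurable_fun setT (fun z : (R * R) * (R * R) => bid z.2 j).
  exact: (measurableT_comp (measurable_bid j)).
rewrite /win_prob; apply: measurable_fun_ifT => //.
  exact: measurable_fun_ltr.
apply: measurable_fun_ifT => //; first exact: measurable_fun_ltr.
have mE c : measurable_fun setT
    (fun z : (R * R) * (R * R) => (bid z.1 j == Lmin B v j) && c).
  apply: measurable_and => //; exact: measurable_fun_eqr.
by apply: measurable_fun_ifT => //; apply: measurable_fun_ifT.
Qed.

Variable Po : probability (R * R)%type R.

(** Taking [fine] loses nothing: the integrand lies in [0, 1], so the integral is finite. *)
Definition win_mean (j : 'I_2) (x : R * R) : R :=
  fine (\int[Po]_y (win j (bid x j) (bid y j))%:E)%E.

Lemma measurable_win_section j (x : R * R) :
  measurable_fun [set: (R * R)%type] (fun y => win j (bid x j) (bid y j)).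
Proof. exact: (measurable_fun_pair2 x (measurable_win_prob j)). Qed.

Lemma integrable_win j (x : R * R) : Po.-integrable setT
  (fun y => (win j (bid x j) (bid y j))%:E).
Proof.
apply: measurable_bounded_integrable => //.
- exact: le_lt_trans (probability_le1 Po measurableT) (ltry 1).
- exact: measurable_win_section.
- exists 1; split => // M M1 y _ /=.
  by rewrite ger0_norm ?win_prob_ge0// (le_trans (win_prob_le1 _ _ _))// ltW.
Qed.

Lemma win_meanE j x :
  (win_mean j x)%:E = (\int[Po]_y (win j (bid x j) (bid y j))%:E)%E.
Proof. by rewrite fineK//; apply: integrable_fin_num => //; exact: integrable_win. Qed.

Lemma win_mean_ge0 j x : 0 <= win_mean j x.
Proof.
by rewrite -lee_fin win_meanE integral_ge0// => y _; rewrite lee_fin win_prob_ge0.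
Qed.

Lemma win_mean_le j x :
  win_mean j x <= fine (Po [set y | bid y j <= bid x j]).
Proof.
have mA := measurable_bid_le j (bid x j).
rewrite -lee_fin win_meanE fineK ?fin_num_measure//.
rewrite -[X in (_ <= _ X)%E]setIT -integral_indic//.
apply: ge0_le_integral => //=.
- by move=> y _; rewrite lee_fin win_prob_ge0.
- apply/measurable_EFinP; exact: measurable_win_section.
- apply/measurable_EFinP; exact: measurable_indic.
- move=> y _; rewrite lee_fin indicE mem_setE; exact: win_prob_le.
Qed.

Lemma win_mean_ge j x :
  fine (Po [set y | bid y j < bid x j]) <= win_mean j x.
Proof.
have mA := measurable_bid_lt j (bid x j).
rewrite -lee_fin win_meanE fineK ?fin_num_measure//.
rewrite -[X in (_ X <= _)%E]setIT -integral_indic//.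
apply: ge0_le_integral => //=.
- apply/measurable_EFinP; exact: measurable_indic.
- apply/measurable_EFinP; exact: measurable_win_section.
- move=> y _; rewrite lee_fin indicE mem_setE; exact: win_prob_ge.
Qed.

Lemma win_mean_le1 j x : win_mean j x <= 1.
Proof.
apply: (le_trans (win_mean_le j x)); have mA := measurable_bid_le j (bid x j).
by rewrite -lee_fin fineK ?fin_num_measure// probability_le1.
Qed.

(** By Tonelli: this is the partial integral of a nonnegative, jointly measurable function. *)
Lemma measurable_win_mean j : measurable_fun setT (win_mean j).
Proof.
apply/measurable_EFinP.
rewrite (_ : _ \o _ = fubini_F Po
  (fun z : (R * R) * (R * R) => (win j (bid z.1 j) (bid z.2 j))%:E)).
  apply: measurable_fun_fubini_tonelli_F => [|z].
    apply/measurable_EFinP; exact: measurable_win_prob.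
  by rewrite lee_fin win_prob_ge0.
by apply/funext => x /=; rewrite win_meanE.
Qed.

Definition payoff (x : R * R) : R :=
  \sum_(j < 2) (win_mean j x * v i j - bid x j).

(** Linearity of the integral splits the utility over items, so the opponent's strategy enters only
    through its marginals. *)
Lemma integral_util x : (\int[Po]_y (util B v i x y)%:E = (payoff x)%:E)%E.
Proof.
have intF j : Po.-integrable setT
    (fun y => (win j (bid x j) (bid y j) * v i j - bid x j)%:E).
  exact: (integrableB measurableT
    (integrableZr measurableT (v i j) (integrable_win j x))
    (finite_measure_integrable_cst Po (bid x j) measurableT)).
rewrite /util /payoff.
under eq_integral do rewrite -sumEFin.
rewrite integral_sum//; rewrite -sumEFin; apply: eq_bigr => j _.
under eq_integral do rewrite EFinB.
rewrite integralB//=; last 2 first.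
- exact: (integrableZr measurableT (v i j) (integrable_win j x)).
- exact: finite_measure_integrable_cst.
rewrite (_ : (\int[Po]_y (win j (bid x j) (bid y j) * v i j)%:E)%E
  = (win_mean j x * v i j)%:E).
  by rewrite (integral_cst_prob1 _ _ _ measurableT) ?probability_setT// EFinB.
under eq_integral do rewrite EFinM.
by rewrite integralZr ?integrable_win// EFinM win_meanE.
Qed.

End BestResponse.

(** * From pointwise payoff bounds to expected utility *)

Section ExpectedUtility.
Context {R : realType}.
Variables (B : 'I_2 -> R) (v : 'I_2 -> 'I_2 -> R) (i : 'I_2).
Hypothesis v_gt0 : forall j, 0 < v i j.
Variables Po Q : probability (R * R)%type R.
Hypothesis mixedQ : mixed_strategy B i Q.
Local Notation payoff := (payoff B v i Po).

Lemma measurable_budget : measurable (budget B i).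
Proof.
have mx (f g : (R * R)%type -> R) : measurable_fun setT f ->
    measurable_fun setT g -> measurable [set x | f x <= g x].
  move=> mf mg; rewrite -[X in measurable X]setTI.
  have /(_ measurableT [set true]) := measurable_fun_ler mf mg.
  exact.
apply: measurableI; first by apply: mx => //; exact: measurable_fst.
apply: measurableI; first by apply: mx => //; exact: measurable_snd.
by apply: mx => //; apply: measurable_funD;
  [exact: measurable_fst|exact: measurable_snd].
Qed.

Lemma measurable_payoff : measurable_fun setT payoff.
Proof.
apply: measurable_sum => j; apply: measurable_funB; last exact: measurable_bid.
by apply: measurable_funM => //; exact: measurable_win_mean.
Qed.

Lemma bid_budget x j : budget B i x -> 0 <= bid x j <= B i.
Proof. by rewrite /bid => -[x1 [x2 xB]]; case: ifP => _; lra. Qed.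

(** The budget confines each bid to [[0, B i]], so each item contributes at most [v i j + B i] in
    absolute value. Outside the budget set the payoff is unbounded, hence the restriction to [D]. *)
Lemma integrable_payoff D : measurable D -> D `<=` budget B i ->
  Q.-integrable D (EFin \o payoff).
Proof.
move=> mD DB; apply: measurable_bounded_integrable => //.
- exact: le_lt_trans (probability_le1 Q mD) (ltry 1).
- exact: measurable_funTS measurable_payoff.
exists (\sum_(j < 2) (v i j + B i)); split => [|M ltM x /DB xB /=]; first exact: num_real.
apply: le_trans (ltW ltM); apply: le_trans (ler_norm_sum _ _ _) _.
apply: ler_sum => j _.
have := bid_budget x j xB.
have := win_mean_ge0 B v i Po j x; have := win_mean_le1 B v i Po j x.
have := v_gt0 j; rewrite ler_norml; nra.
Qed.

(** The complement of [D] is null, so the integral may be moved to [D], where the payoff is bounded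
    and comparison with constants is possible. *)
Lemma exp_utilE D : measurable D -> D `<=` budget B i -> Q D = 1%E ->
  exp_util B v i Q Po = (\int[Q]_(x in D) (payoff x)%:E)%E.
Proof.
move=> mD DB QD; rewrite /exp_util.
under eq_integral do rewrite integral_util.
have QDC : Q (~` D) = 0%E by exact: prob1_setC.
have mDC := measurableC mD.
rewrite (negligible_integral _ _ _ QDC) ?setDE ?setCK ?setTI//.
apply/(negligible_integrable mDC) => //.
  by apply/measurable_EFinP; exact: measurable_payoff.
by rewrite setDE setCK setTI; exact: integrable_payoff.
Qed.

Lemma exp_util_le (c : R) : (forall x, budget B i x -> payoff x <= c) ->
  (exp_util B v i Q Po <= c%:E)%E.
Proof.
have mB := measurable_budget; move=> le_c.
rewrite (exp_utilE _ mB)// -(integral_cst_prob1 _ _ c mB mixedQ).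
apply: le_integral => //; first exact: integrable_payoff.
  exact: finite_measure_integrable_cst.
by move=> x /set_mem xB; rewrite lee_fin le_c.
Qed.

Lemma exp_util_ge (c : R) D : measurable D -> Q D = 1%E ->
  (forall x, budget B i x -> D x -> c <= payoff x) ->
  (c%:E <= exp_util B v i Q Po)%E.
Proof.
have mB := measurable_budget; move=> mD QD ge_c.
have mDB : measurable (budget B i `&` D) by exact: measurableI.
have QDB : Q (budget B i `&` D) = 1%E by exact: prob1_setI.
have DB : budget B i `&` D `<=` budget B i by move=> x [].
rewrite (exp_utilE _ mDB DB QDB).
rewrite -[X in (X <= _)%E](integral_cst_prob1 _ _ c mDB QDB).
apply: le_integral => //; first exact: finite_measure_integrable_cst.
  exact: integrable_payoff.
by move=> x /set_mem[xB xD]; rewrite lee_fin ge_c.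
Qed.

End ExpectedUtility.

(* The tie-breaking rule plays no role: the expected number of wins at bid [a]
   lies between the probabilities that the opponent bids [< a] and [<= a]. *)
Lemma best_response {R : realType} (B : 'I_2 -> R) (v : 'I_2 -> 'I_2 -> R)
    (i : 'I_2) (Pi Po : probability (R * R)%type R) (c : 'I_2 -> R)
    (D : set (R * R)) :
  (forall j, 0 < v i j) ->
  (forall j a, 0 <= a -> v i j * fine (Po [set y | bid y j <= a]) - a <= c j) ->
  measurable D -> Pi D = 1%E ->
  (forall j x, D x -> c j <= v i j * fine (Po [set y | bid y j < bid x j]) - bid x j) ->
  mixed_strategy B i Pi ->
  forall Q, mixed_strategy B i Q ->
    (exp_util B v i Q Po <= exp_util B v i Pi Po)%E.
Proof.
move=> v0 le_c mD PD ge_c mixP Q mixQ.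
(* The sum of the [c j] separates the two sides: no feasible bid earns more, and [Pi]-almost every
   bid earns at least that much. *)
apply: (@le_trans _ _ (\sum_(j < 2) c j)%:E).
  apply: exp_util_le => // x xB; apply: ler_sum => j _.
  have /andP[x0 _] := bid_budget B i x j xB.
  apply: le_trans (le_c j _ x0); rewrite mulrC lerD2r ler_pM2l//.
  exact: win_mean_le.
apply: exp_util_ge PD _ => // x xB xD; apply: ler_sum => j _.
apply: le_trans (ge_c j x xD) _; rewrite [X in _ <= X - _]mulrC lerD2r ler_pM2l//.
exact: win_mean_ge.
Qed.

(** * Mixtures, and uniform laws on segments *)

Lemma mixture_exists {d} {T : measurableType d} {R : realType}
    (P1 P2 P3 : probability T R) (a b c : R) :
  0 <= a -> 0 <= b -> 0 <= c -> a + b + c = 1 ->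
  exists P : probability T R,
    forall A, (P A = a%:E * P1 A + b%:E * P2 A + c%:E * P3 A)%E.
Proof.
move=> a0 b0 c0 abc.
pose m12 : {measure set T -> \bar R} :=
  measure_add (mscale (NngNum a0) P1) (mscale (NngNum b0) P2).
pose m : {measure set T -> \bar R} := measure_add m12 (mscale (NngNum c0) P3).
have mE A : (m A = a%:E * P1 A + b%:E * P2 A + c%:E * P3 A)%E.
  transitivity (m12 A + c%:E * P3 A)%E; first exact: measure_addE.
  by congr (_ + _)%E; exact: measure_addE.
have m1 : m setT = 1%E.
  by rewrite mE !probability_setT !mule1 -!EFinD abc.
pose P := HB.pack_for (probability T R) (Measure.sort m)
  (Measure_isProbability.Build _ _ _ m m1).
by exists P.
Qed.

Section UniformOnSegment.
Context {R : realType}.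
Implicit Types (p q : R * R) (A : set (R * R)).

Definition seg_point p q (t : R) : R * R :=
  (p.1 + t * (q.1 - p.1), p.2 + t * (q.2 - p.2)).

(** The law of [seg_point p q t] for [t] uniform on [0, 1]. Using the parameter instead of arc
    length keeps the case [p = q] meaningful: it is then the Dirac mass at [p]. *)
Definition uniform_on (P : probability (R * R)%type R) p q :=
  forall A, measurable A ->
    P A = lebesgue_measure [set t : R | 0 <= t <= 1 /\ A (seg_point p q t)].

Lemma bid_seg_point p q t j :
  bid (seg_point p q t) j = bid p j + t * (bid q j - bid p j).
Proof. by rewrite /bid; case: ifP. Qed.

Lemma measurable_seg_point p q : measurable_fun setT (seg_point p q).
Proof.
apply/measurable_fun_pair; apply: measurable_funD => //; exact: measurable_funM.
Qed.

Lemma measurable_seg_preimage p q A : measurable A ->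
  measurable [set t : R | 0 <= t <= 1 /\ A (seg_point p q t)].
Proof.
move=> mA; rewrite (_ : mkset _ = `[0%R, 1%R]%classic `&` seg_point p q @^-1` A).
  apply: measurableI => //; rewrite -[X in measurable X]setTI.
  exact: measurable_seg_point.
by apply/seteqP; split => t /=; rewrite in_itv.
Qed.

Lemma uniform_on_exists p q :
  exists P : probability (R * R)%type R, uniform_on P p q.
Proof.
pose f : {mfun measurableTypeR R >-> (R * R)%type} :=
  HB.pack (seg_point p q : measurableTypeR R -> (R * R)%type)
    (isMeasurableFun.Build _ _ (measurableTypeR R) _ _ (measurable_seg_point p q)).
(* Push the uniform law on [0, 1] forward along the parametrisation. *)
exists (distribution (uniform_prob (@ltr01 R)) f) => A mA.
have mS := measurable_seg_preimage p q A mA.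
transitivity (\int[lebesgue_measure]_(t in seg_point p q @^-1` A)
    (uniform_pdf 0 1 t)%:E)%E; first by [].
rewrite integral_uniform_pdf.
rewrite (_ : _ `&` _ = [set t : R | 0 <= t <= 1 /\ A (seg_point p q t)]).
  rewrite -[RHS]mul1e -integral_cst//; apply: eq_integral => t /set_mem[t01 _].
  by rewrite /uniform_pdf t01 subr0 invr1.
by apply/seteqP; split => t /=; rewrite in_itv /=; tauto.
Qed.

Variables (P : probability (R * R)%type R) (p q : R * R).
Hypothesis unifP : uniform_on P p q.

Lemma uniform_on_le A (u1 u2 : R) : measurable A ->
  (forall t, 0 <= t <= 1 -> A (seg_point p q t) -> u1 <= t <= u2) ->
  fine (P A) <= Num.max 0 (u2 - u1).
Proof.
move=> mA sub; rewrite -lee_fin fineK ?fin_num_measure// unifP//.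
apply: (@le_trans _ _ (lebesgue_measure (`[u1, u2]%classic : set R))).
  apply: le_measure; rewrite ?inE//; first exact: measurable_seg_preimage.
  by move=> t [t01 /(sub t t01)] /=; rewrite in_itv.
rewrite lebesgue_measure_itv /= lte_fin; case: ifPn => u12.
  by rewrite -EFinB lee_fin le_max lexx orbT.
by rewrite lee_fin le_max lexx.
Qed.

Lemma uniform_on_ge A (u1 u2 : R) : measurable A ->
  (forall t, u1 < t < u2 -> 0 <= t <= 1 /\ A (seg_point p q t)) ->
  u2 - u1 <= fine (P A).
Proof.
move=> mA sub; rewrite -lee_fin fineK ?fin_num_measure// unifP//.
apply: (@le_trans _ _ (lebesgue_measure (`]u1, u2[%classic : set R))).
  rewrite lebesgue_measure_itv /= lte_fin; case: ifPn => u12.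
    by rewrite EFinB.
  by rewrite lee_fin subr_le0 leNgt.
apply: le_measure; rewrite ?inE//.
exact: measurable_seg_preimage.
Qed.

Lemma uniform_on_eq1 A : measurable A ->
  (forall t, 0 < t < 1 -> A (seg_point p q t)) -> P A = 1%E.
Proof.
move=> mA sub; apply/eqP; rewrite eq_le probability_le1//=.
rewrite -[X in (_ <= X)%E]fineK ?fin_num_measure// lee_fin -[leLHS]subr0.
by apply: uniform_on_ge => // t t01; split; [lra|exact: sub].
Qed.

(** A coordinate is affine in the parameter, so its law is uniform between its endpoint values.
    Multiplying by the width avoids a division and covers the case where the coordinate is
    constant. *)
Lemma uniform_on_cdf_le j (a : R) :
  `|bid q j - bid p j| * fine (P [set y | bid y j <= a])
    <= Num.max 0 (a - Num.min (bid p j) (bid q j)).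
Proof.
have mA := measurable_bid_le j a.
have := uniform_on_le [set y | bid y j <= a] _ _ mA.
case: (ltgtP (bid p j) (bid q j)) => [pq|qp|->].
(* The upper limit is the parameter at which the coordinate equals [a]; for a decreasing coordinate
   the same parameter is the lower limit. *)
- move=> /(_ 0 ((a - bid p j) / (bid q j - bid p j))).
  have uE : (a - bid p j) / (bid q j - bid p j) * (bid q j - bid p j) = a - bid p j.
    by rewrite divfK// subr_eq0 gt_eqF.
  rewrite gtr0_norm ?subr_gt0// => le_u.
  have {le_u} := le_u _; set u := _ / _ in uE *; rewrite le_max => le_u.
  have {le_u} /orP[] : (fine (P [set y | bid y j <= a]) <= 0)
      || (fine (P [set y | bid y j <= a]) <= u - 0).
  + apply: le_u => t t01 /=; rewrite bid_seg_point => ta.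
    by rewrite (andP t01).1 /= /u ler_pdivlMr ?subr_gt0//; lra.
  + by rewrite le_max => le0; apply/orP; left; nra.
  + by rewrite le_max => le0; apply/orP; right; nra.
- move=> /(_ ((bid p j - a) / (bid p j - bid q j)) 1).
  have uE : (bid p j - a) / (bid p j - bid q j) * (bid p j - bid q j) = bid p j - a.
    by rewrite divfK// subr_eq0 gt_eqF.
  rewrite ltr0_norm ?subr_lt0// opprB => le_u.
  have {le_u} := le_u _; set u := _ / _ in uE *; rewrite le_max => le_u.
  have {le_u} /orP[] : (fine (P [set y | bid y j <= a]) <= 0)
      || (fine (P [set y | bid y j <= a]) <= 1 - u).
  + apply: le_u => t t01 /=; rewrite bid_seg_point => ta.
    by rewrite (andP t01).2 andbT /u ler_pdivrMr ?subr_gt0//; lra.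
  + by rewrite le_max => le0; apply/orP; left; nra.
  + by rewrite le_max => le0; apply/orP; right; nra.
- by move=> _; rewrite subrr normr0 mul0r le_max lexx.
Qed.

(** The matching lower bound, with strict inequality in the event because a bid surely wins only
    against strictly smaller ones. *)
Lemma uniform_on_cdf_ge j (a : R) :
  Num.min (bid p j) (bid q j) <= a <= Num.max (bid p j) (bid q j) ->
  a - Num.min (bid p j) (bid q j)
    <= `|bid q j - bid p j| * fine (P [set y | bid y j < a]).
Proof.
have mA := measurable_bid_lt j a.
case: (ltgtP (bid p j) (bid q j)) => [pq|qp|->] /andP[a1 a2].
- rewrite gtr0_norm ?subr_gt0// mulrC -ler_pdivrMr ?subr_gt0//.
  rewrite -[leLHS]subr0; apply: uniform_on_ge => // t /andP[t0].
  rewrite ltr_pdivlMr ?subr_gt0// => ta; rewrite /= bid_seg_point.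
  split; last lra.
  rewrite (ltW t0) /= -(ler_pM2r (x := bid q j - bid p j)) ?subr_gt0//; lra.
- rewrite ltr0_norm ?subr_lt0// opprB mulrC -ler_pdivrMr ?subr_gt0//.
  (* The coordinate decreases, so the bids below [a] correspond to the parameters after the crossing
     point; their interval ends at 1. *)
  rewrite (_ : _ / _ = 1 - (bid p j - a) / (bid p j - bid q j)); last first.
    by field; rewrite subr_eq0 gt_eqF.
  apply: uniform_on_ge => // t /andP[+ t1].
  rewrite ltr_pdivrMr ?subr_gt0// => ta; rewrite /= bid_seg_point.
  split; last lra.
  rewrite (ltW t1) andbT -(ler_pM2r (x := bid p j - bid q j)) ?subr_gt0//; lra.
- by rewrite subrr normr0 mul0r; lra.
Qed.

Lemma uniform_on_cdf_eq1 j (a : R) : bid p j < a -> bid q j < a ->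
  fine (P [set y | bid y j < a]) = 1.
Proof.
move=> pa qa; rewrite uniform_on_eq1 => [//||t t01].
  exact: measurable_bid_lt.
rewrite /= bid_seg_point; nra.
Qed.

End UniformOnSegment.

(** * Arc-length densities as mixtures of uniform laws *)

Lemma prob_fine_le1 {d} {T : measurableType d} {R : realType}
    (P : probability T R) (A : set T) : measurable A -> fine (P A) <= 1.
Proof. by move=> mA; rewrite -lee_fin fineK ?fin_num_measure// probability_le1. Qed.

Lemma prob1_setIr {d} {T : measurableType d} {R : realType}
    (P : probability T R) (A D : set T) :
  measurable A -> measurable D -> P D = 1%E -> P (A `&` D) = P A.
Proof.
move=> mA mD PD; rewrite -[in RHS](setIT A) -(setvU D) setIUr measureU.
- rewrite [X in (X + _)%E](subset_measure0 (B := ~` D)) ?add0e//.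
  + by apply: measurableI => //; exact: measurableC.
  + exact: measurableC.
  + exact: prob1_setC.
- by apply: measurableI => //; exact: measurableC.
- exact: measurableI.
- by rewrite setIACA setICl setI0.
Qed.

Section SegmentLength.
Context {R : realType}.

Definition seg_norm (p q : R * R) : R :=
  Num.sqrt ((q.1 - p.1) ^+ 2 + (q.2 - p.2) ^+ 2).

Lemma seg_length_uniform (P : probability (R * R)%type R) (p q : R * R)
    (A S : set (R * R)) : uniform_on P p q -> measurable A ->
  (forall t, 0 <= t <= 1 -> S (seg_point p q t)) ->
  seg_length p q (A `&` S) = ((seg_norm p q)%:E * P A)%E.
Proof.
move=> unifP mA pqS; rewrite unifP//; congr (_ * lebesgue_measure _)%E.
by apply/seteqP; split => t /= [t01]; [case|move=> At; split=> //; split=> //; exact: pqS].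
Qed.

(** The density is the reciprocal of the length of the segment, so the two factors cancel. *)
Lemma f_w_uniform (L1 L2 : R) (P : probability (R * R)%type R) :
  0 < L1 -> 0 < L2 -> uniform_on P (0, L2) (L1, 0) -> represents (f_w L1 L2) P.
Proof.
move=> L10 L20 unifP A mA; rewrite /f_w (seg_length_uniform _ _ _ _ _ unifP)//.
  rewrite /seg_norm /= subr0 sub0r sqrrN muleA -EFinM mul1r mulVf ?mul1e//.
  by rewrite gt_eqF// sqrtr_gt0 ltr_pwDl ?exprn_gt0// sqr_ge0.
move=> t /andP[t0 t1]; rewrite /= add0r subr0 sub0r; split; [nra|split; [nra|]].
by field; rewrite gt_eqF.
Qed.

(** Each weight is density times length. Since [T1 = k * v1] and [T2 = k * v2], the oblique piece
    has mass [k], and the axis pieces have masses [(L1 - T1) / v1 = 1 - L2 / v2] and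
    [(L2 - T2) / v2 = 1 - L1 / v1]. *)
Lemma f_s_mixture (L1 L2 v1 v2 : R) (P1 P2 P3 P : probability (R * R)%type R)
    (T1 := L1 - v1 + L2 / v2 * v1) (T2 := L2 - v2 + L1 / v1 * v2)
    (k := L1 / v1 + L2 / v2 - 1) :
  0 < v1 -> 0 < v2 -> L1 <= v1 -> L2 <= v2 -> 0 <= k ->
  uniform_on P1 (0, T2) (T1, 0) ->
  uniform_on P2 (T1, 0) (L1, 0) ->
  uniform_on P3 (0, T2) (0, L2) ->
  (forall A, P A = k%:E * P1 A + (1 - L2 / v2)%:E * P2 A
                     + (1 - L1 / v1)%:E * P3 A)%E ->
  represents (f_s L1 L2 v1 v2) P.
Proof.
move=> v10 v20 Lv1 Lv2 k0 unif1 unif2 unif3 PE A mA.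
have nz1 : v1 != 0 by rewrite gt_eqF.
have nz2 : v2 != 0 by rewrite gt_eqF.
have L1E : L1 - T1 = (1 - L2 / v2) * v1 by rewrite /T1; field; rewrite ?nz1 ?nz2.
have L2E : L2 - T2 = (1 - L1 / v1) * v2 by rewrite /T2; field; rewrite ?nz1 ?nz2.
have T1E : T1 = k * v1 by rewrite /T1 /k; field; rewrite ?nz1 ?nz2.
have T2E : T2 = k * v2 by rewrite /T2 /k; field; rewrite ?nz1 ?nz2.
have LT1 : 0 <= L1 - T1.
  by rewrite L1E mulr_ge0 ?(ltW v10)// subr_ge0 ler_pdivrMr// mul1r.
have LT2 : 0 <= L2 - T2.
  by rewrite L2E mulr_ge0 ?(ltW v20)// subr_ge0 ler_pdivrMr// mul1r.
rewrite PE /f_s -/T1 -/T2 -/k; congr (_ + _ + _)%E.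
(* If [k = 0] the oblique segment shrinks to the origin and its length cannot be cancelled, but the
   numerator of the density vanishes, so both terms are 0. *)
- have [k_eq0|k_neq0] := eqVneq k 0; first by rewrite k_eq0 !mul0r !mul0e.
  have k_gt0 : 0 < k by rewrite lt_neqAle eq_sym k_neq0.
  have T10 : 0 < T1 by rewrite T1E mulr_gt0.
  have T20 : 0 < T2 by rewrite T2E mulr_gt0.
  (* The half-open conditions of the oblique piece exclude both endpoints of the segment. The event
     [D] removes exactly these from the segment, at no cost in probability. *)
  set D := [set y : R * R | bid y ord0 < T1] `&` ~` [set y : R * R | bid y ord0 <= 0].
  have mD : measurable D.
    by apply: measurableI; [exact: measurable_bid_lt|
      apply: measurableC; exact: measurable_bid_le].
  have PD : P1 D = 1%E.
    apply: (uniform_on_eq1 _ _ _ unif1) => // t t01.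
    by split; rewrite /= bid_seg_point /bid /=; [|move=> ?]; nra.
  rewrite -(prob1_setIr P1 A D mA mD PD).
  have mAD : measurable (A `&` D) by exact: measurableI.
  rewrite unif1// /seg_length /= subr0 sub0r sqrrN muleA -EFinM divfK; last first.
    by rewrite gt_eqF// sqrtr_gt0 ltr_pwDl ?exprn_gt0// sqr_ge0.
  congr (_ * lebesgue_measure _)%E; apply/seteqP; split => t /=.
    move=> [t01 [At [Dt1 Dt2]]]; split => //.
    move: At Dt1 Dt2; rewrite /seg_point /bid /= subr0 sub0r => At Dt1 Dt2.
    split => //; split; [lra|split].
      have : 0 < t by nra.
      nra.
    by field; rewrite gt_eqF.
  move=> [t01 [At [Dt1 [Dt2 _]]]]; split => //; split.
    by move: At; rewrite /seg_point /= subr0 sub0r.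
  by split; rewrite /= bid_seg_point /bid /=; [|move=> ?]; nra.
- rewrite (seg_length_uniform _ _ _ _ _ unif2)//.
    rewrite /seg_norm /= subrr expr0n addr0 sqrtr_sqr ger0_norm// L1E.
    by rewrite muleA -EFinM; congr (_%:E * _)%E; field; rewrite gt_eqF.
  by move=> t /andP[t0 t1]; rewrite /= subrr mulr0 addr0; split => //; nra.
- rewrite (seg_length_uniform _ _ _ _ _ unif3)//.
    rewrite /seg_norm /= subrr expr0n add0r sqrtr_sqr ger0_norm// L2E.
    by rewrite muleA -EFinM; congr (_%:E * _)%E; field; rewrite gt_eqF.
  by move=> t /andP[t0 t1]; rewrite /= subrr mulr0 addr0; split => //; nra.
Qed.

End SegmentLength.

(** * Marginals of the stronger player's strategy *)

(* On each item the stronger player's bid has an atom of mass [1 - L / v] at [0]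
   and density [1 / v] on [[0, L]]: the oblique piece covers [[0, T]], one axis
   piece covers [[T, L]], and the other axis piece produces the atom. *)
Section StrongMarginal.
Context {R : realType}.
Variables (P1 Pa P0 P : probability (R * R)%type R).
Variables (p1 q1 pa qa p0 q0 : R * R) (j : 'I_2) (T L v : R).
Hypotheses (unif1 : uniform_on P1 p1 q1) (unifa : uniform_on Pa pa qa)
  (unif0 : uniform_on P0 p0 q0).
Hypothesis pq1 :
  bid p1 j = 0 /\ bid q1 j = T \/ bid p1 j = T /\ bid q1 j = 0.
Hypotheses (paT : bid pa j = T) (qaL : bid qa j = L).
Hypotheses (p00 : bid p0 j = 0) (q00 : bid q0 j = 0).
Hypotheses (T_ge0 : 0 <= T) (T_leL : T <= L) (L_lev : L <= v).
Hypothesis PE : forall A, measurable A -> v * fine (P A) =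
  T * fine (P1 A) + (L - T) * fine (Pa A) + (v - L) * fine (P0 A).

Let pq1E : [/\ `|bid q1 j - bid p1 j| = T, Num.min (bid p1 j) (bid q1 j) = 0
  & Num.max (bid p1 j) (bid q1 j) = T].
Proof.
case: pq1 => -[-> ->]; rewrite ?subr0 ?sub0r ?normrN ger0_norm//; split=> //.
- exact: min_l.
- exact: max_r.
- exact: min_r.
- exact: max_l.
Qed.

(** The atom contributes at most [v - L], the oblique piece at most the minimum of [a] and [T], and
    the axis piece at most the positive part of [a - T]; the last two add up to [a]. *)
Lemma strong_marginal_le a : 0 <= a ->
  v * fine (P [set y | bid y j <= a]) - a <= v - L.
Proof.
move=> a0; have mA := measurable_bid_le j a; rewrite PE//.
have [d1 m1 _] := pq1E.
have := uniform_on_cdf_le _ _ _ unif1 j a; rewrite d1 m1 subr0 (max_r a0).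
have := uniform_on_cdf_le _ _ _ unifa j a.
rewrite paT qaL (min_l T_leL) ger0_norm ?subr_ge0//.
have := ler_piMr T_ge0 (prob_fine_le1 P1 _ mA).
have vL : 0 <= v - L by rewrite subr_ge0.
have := ler_piMr vL (prob_fine_le1 P0 _ mA).
by case: (leP 0 (a - T)); lra.
Qed.

(** As [a > 0], the atom at 0 lies strictly below [a] and counts in full. Up to [T] the oblique
    piece supplies [a]; beyond [T] it supplies [T] and the axis piece the remaining [a - T]. *)
Lemma strong_marginal_ge a : 0 < a <= L ->
  v - L <= v * fine (P [set y | bid y j < a]) - a.
Proof.
move=> /andP[a0 aL]; have mA := measurable_bid_lt j a; rewrite PE//.
have [d1 m1 M1] := pq1E.
rewrite (uniform_on_cdf_eq1 _ _ _ unif0) ?p00 ?q00// mulr1.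
have Fa0 : 0 <= fine (Pa [set y | bid y j < a]) by rewrite fine_ge0.
have [aT|Ta] := leP a T.
  have := uniform_on_cdf_ge _ _ _ unif1 j a.
  rewrite d1 m1 M1 (ltW a0) aT subr0 => /(_ isT) F1.
  have : 0 <= (L - T) * fine (Pa [set y | bid y j < a]).
    by rewrite mulr_ge0// subr_ge0.
  lra.
rewrite (uniform_on_cdf_eq1 _ _ _ unif1); [|by case: pq1 => -[]; lra|by case: pq1 => -[]; lra].
have := uniform_on_cdf_ge _ _ _ unifa j a.
rewrite paT qaL (min_l T_leL) (max_r T_leL) (ltW Ta) aL => /(_ isT).
by rewrite ger0_norm ?subr_ge0//; lra.
Qed.

End StrongMarginal.

(** * Assembly of the equilibrium *)

Lemma mixture_fine {d} {T : measurableType d} {R : realType}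
    (P P1 P2 P3 : probability T R) (a b c : R) :
  (forall A, P A = a%:E * P1 A + b%:E * P2 A + c%:E * P3 A)%E ->
  forall A, measurable A ->
    fine (P A) = a * fine (P1 A) + b * fine (P2 A) + c * fine (P3 A).
Proof.
move=> PE A mA; apply: EFin_inj.
by rewrite !EFinD !EFinM !fineK ?fin_num_measure.
Qed.

Lemma mixture_eq1 {d} {T : measurableType d} {R : realType}
    (P P1 P2 P3 : probability T R) (a b c : R) :
  a + b + c = 1 ->
  (forall A, P A = a%:E * P1 A + b%:E * P2 A + c%:E * P3 A)%E ->
  forall A, P1 A = 1%E -> P2 A = 1%E -> P3 A = 1%E -> P A = 1%E.
Proof. by move=> abc PE A PA1 PA2 PA3; rewrite PE PA1 PA2 PA3 !mule1 -!EFinD abc. Qed.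

Lemma measurable_box {R : realType} (u : 'I_2 -> R) :
  measurable [set x : R * R | forall j, bid x j <= u j].
Proof.
rewrite (_ : mkset _ = [set x | bid x ord0 <= u ord0] `&`
  [set x | bid x 1%R <= u 1%R]).
  by apply: measurableI; exact: measurable_bid_le.
by apply/seteqP; split => x /= => [xu|[]]; [split|exact: forall_I2].
Qed.

Lemma Lmin_le {R : realType} (B : 'I_2 -> R) (v : 'I_2 -> 'I_2 -> R) i j :
  Lmin B v j <= B i /\ Lmin B v j <= v i j.
Proof.
by rewrite /Lmin; move: i; apply: forall_I2; split; rewrite !ge_min lexx ?orbT.
Qed.

Theorem theorem4 (R : realType) (B : 'I_2 -> R) (v : 'I_2 -> 'I_2 -> R)
  (s w : 'I_2)
  (hB : forall i, 0 <= B i)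
  (hv : forall i j, 0 < v i j)
  (hB12 : B ord0 != B 1%R)
  (hs : B w < B s) (* s = argmax_i B_i, w the other player *)
  (hvs1 : v s ord0 = Lmin B v ord0)
  (hvs2 : v s 1%R = Lmin B v 1%R)
  (* well-definedness of f_s as a probability distribution: T_1, T_2 >= 0 *)
  (hT : 1 <= Lmin B v ord0 / v w ord0 + Lmin B v 1%R / v w 1%R) :
  nash_equilibrium B v
    (fun i => if i == s
              then f_s (Lmin B v ord0) (Lmin B v 1%R) (v w ord0) (v w 1%R)
              else f_w (Lmin B v ord0) (Lmin B v 1%R)).
Proof.
have ws : w != s by apply/eqP => ws; rewrite ws ltxx in hs.
have vsL : forall j, v s j = Lmin B v j by apply: forall_I2.
have L_gt0 j : 0 < Lmin B v j by rewrite -vsL.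
have [LB0 Lv0] := (fun i => (Lmin_le B v i ord0).1, (Lmin_le B v w ord0).2).
have [LB1 Lv1] := (fun i => (Lmin_le B v i 1%R).1, (Lmin_le B v w 1%R).2).
have L0_gt0 := L_gt0 ord0; have L1_gt0 := L_gt0 1%R.
have v0 := hv w ord0; have v1 := hv w 1%R.
move: hvs1 hvs2 => _ _.
(* Indices now start at 0: [L0] and [T0] belong to the first item, [L1] and [T1] to the second. *)
set L0 := Lmin B v ord0 in hT LB0 Lv0 L0_gt0 *.
set L1 := Lmin B v 1%R in hT LB1 Lv1 L1_gt0 *.
have nz0 : v w ord0 != 0 by rewrite gt_eqF.
have nz1 : v w 1%R != 0 by rewrite gt_eqF.
set T0 := L0 - v w ord0 + L1 / v w 1%R * v w ord0.
set T1 := L1 - v w 1%R + L0 / v w ord0 * v w 1%R.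
set k := L0 / v w ord0 + L1 / v w 1%R - 1.
have k_ge0 : 0 <= k by rewrite /k; lra.
have r0_le1 : L0 / v w ord0 <= 1 by rewrite ler_pdivrMr// mul1r.
have r1_le1 : L1 / v w 1%R <= 1 by rewrite ler_pdivrMr// mul1r.
(* Both thresholds are multiples of [k], so [hT] gives their nonnegativity. *)
have T0E : v w ord0 * k = T0 by rewrite /T0 /k; field; rewrite ?nz0 ?nz1.
have T1E : v w 1%R * k = T1 by rewrite /T1 /k; field; rewrite ?nz0 ?nz1.
have LT0E : v w ord0 * (1 - L1 / v w 1%R) = L0 - T0.
  by rewrite /T0; field; rewrite ?nz0 ?nz1.
have LT1E : v w 1%R * (1 - L0 / v w ord0) = L1 - T1.
  by rewrite /T1; field; rewrite ?nz0 ?nz1.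
have vL0E : v w ord0 * (1 - L0 / v w ord0) = v w ord0 - L0 by field.
have vL1E : v w 1%R * (1 - L1 / v w 1%R) = v w 1%R - L1 by field.
have T0_ge0 : 0 <= T0 by rewrite -T0E mulr_ge0// ltW.
have T1_ge0 : 0 <= T1 by rewrite -T1E mulr_ge0// ltW.
have TL0 : T0 <= L0 by rewrite -subr_ge0 -LT0E mulr_ge0// ?subr_ge0// ltW.
have TL1 : T1 <= L1 by rewrite -subr_ge0 -LT1E mulr_ge0// ?subr_ge0// ltW.
have [Pw unifw] := uniform_on_exists (0, L1) (L0, 0).
have [P1 unif1] := uniform_on_exists (0, T1) (T0, 0).
have [P2 unif2] := uniform_on_exists (T0, 0) (L0, 0).
have [P3 unif3] := uniform_on_exists (0, T1) (0, L1).
have kE : k + (1 - L1 / v w 1%R) + (1 - L0 / v w ord0) = 1 by rewrite /k; ring.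
have [Ps PsE] := mixture_exists P1 P2 P3 k (1 - L1 / v w 1%R)
  (1 - L0 / v w ord0) k_ge0 ltac:(lra) ltac:(lra) kE.
have mixw : mixed_strategy B w Pw.
  apply: (uniform_on_eq1 _ _ _ unifw); first exact: measurable_budget.
  have := LB0 w; have := LB1 w.
  by move=> B1 B0 t /andP[t0 t1]; rewrite /budget /=; split; [|split]; nra.
have mixs : mixed_strategy B s Ps.
  have mb := measurable_budget B s.
  have := LB0 s; have := LB1 s => B1 B0.
  apply: (mixture_eq1 _ _ _ _ _ _ _ kE PsE);
    [apply: (uniform_on_eq1 _ _ _ unif1)|apply: (uniform_on_eq1 _ _ _ unif2)
    |apply: (uniform_on_eq1 _ _ _ unif3)] => // t /andP[t0 t1];
    by rewrite /budget /=; split; [|split]; nra.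
have sI i : i = s \/ i = w.
  have [->|i_s] := eqVneq i s; [by left|right].
  by rewrite -(oppP _ _ i_s) -(oppP _ _ ws).
have opps : Defs.opp s = w by exact: oppP.
have oppw : Defs.opp w = s by apply: oppP; rewrite eq_sym.
exists (fun i => if i == s then Ps else Pw); split; [|split].
- move=> i; case: ifP => _; last exact: f_w_uniform.
  exact: (f_s_mixture _ _ _ _ P1 P2 P3).
- by move=> i; case: (sI i) => ->; rewrite ?eqxx ?(negbTE ws).
move=> i; case: (sI i) => ->.
  rewrite opps eqxx (negbTE ws).
  (* Player [s] can earn at most 0 on each item because [v s j] equals [Lmin B v j]; every bid in
     the box earns at least that. *)
  apply: (best_response _ _ _ _ _ (fun=> 0)
    [set x : R * R | forall j, bid x j <= Lmin B v j]) => //.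
  + move=> j a a0; rewrite vsL subr_le0.
    have := uniform_on_cdf_le _ _ _ unifw j a; move: j; apply: forall_I2.
    * by rewrite /bid /= subr0 (gtr0_norm L0_gt0) (min_l (ltW L0_gt0)) subr0 max_r.
    * by rewrite /bid /= sub0r normrN (gtr0_norm L1_gt0) (min_r (ltW L1_gt0)) subr0 max_r.
  + exact: measurable_box.
  + have mbox := measurable_box (Lmin B v).
    apply: (mixture_eq1 _ _ _ _ _ _ _ kE PsE);
    [apply: (uniform_on_eq1 _ _ _ unif1)|apply: (uniform_on_eq1 _ _ _ unif2)
    |apply: (uniform_on_eq1 _ _ _ unif3)] => // t /andP[t0 t1];
    by apply: forall_I2; rewrite bid_seg_point /bid /= -/L0 -/L1; nra.
  + move=> j x xL; rewrite vsL subr_ge0.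
    (* The box does not bound bids from below, and the distribution bound needs a bid in
       [[0, Lmin B v j]]; at nonpositive bids the claim is a sign argument. *)
    have [x0|x0] := leP (bid x j) 0.
      by rewrite (le_trans x0)// mulr_ge0 ?fine_ge0// ltW.
    have := uniform_on_cdf_ge _ _ _ unifw j (bid x j).
    move: j (xL j) x0; apply: forall_I2 => xL' /ltW x0.
    * rewrite [bid (0, _) _]/bid [bid (L0, _) _]/bid /= subr0 (gtr0_norm L0_gt0).
      by rewrite (min_l (ltW L0_gt0)) (max_r (ltW L0_gt0)) x0 subr0; exact.
    * rewrite [bid (0, _) _]/bid [bid (L0, _) _]/bid /= sub0r normrN.
      rewrite (gtr0_norm L1_gt0).
      by rewrite (min_r (ltW L1_gt0)) (max_l (ltW L1_gt0)) x0 subr0; exact.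
rewrite oppw eqxx (negbTE ws).
(* On the first item [P2] spreads over [[T0, L0]] and [P3] forms the atom at 0; on the second item
   they exchange roles. *)
have PsE0 A : measurable A -> v w ord0 * fine (Ps A) =
    T0 * fine (P1 A) + (L0 - T0) * fine (P2 A) + (v w ord0 - L0) * fine (P3 A).
  by move=> mA; rewrite (mixture_fine _ _ _ _ _ _ _ PsE)// !mulrDr !mulrA
    T0E LT0E vL0E.
have PsE1 A : measurable A -> v w 1%R * fine (Ps A) =
    T1 * fine (P1 A) + (L1 - T1) * fine (P3 A) + (v w 1%R - L1) * fine (P2 A).
  by move=> mA; rewrite (mixture_fine _ _ _ _ _ _ _ PsE)// !mulrDr !mulrA
    T1E LT1E vL1E addrAC.
(* The bids of [w] must also be positive, so as to beat the atom at 0 surely; this discards only the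
   endpoints of the segment. *)
apply: (best_response _ _ _ _ _ (fun j => v w j - Lmin B v j)
  ([set x : R * R | forall j, bid x j <= Lmin B v j] `&`
   (~` [set x | bid x ord0 <= 0] `&` ~` [set x | bid x 1%R <= 0]))) => //.
- move=> + a a0; apply: forall_I2.
  (* Along the oblique segment from [(0, T1)] to [(T0, 0)] the first bid increases ([left]) and the
     second decreases ([right]). *)
  + by apply: (strong_marginal_le P1 P2 P3 Ps _ _ _ _ _ T0 _ _
      unif1 unif2) => //; left.
  + by apply: (strong_marginal_le P1 P3 P2 Ps _ _ _ _ _ T1 _ _
      unif1 unif3) => //; right.
- by apply: measurableI; [exact: measurable_box|
    apply: measurableI; apply: measurableC; exact: measurable_bid_le].
- apply: (uniform_on_eq1 _ _ _ unifw).
    by apply: measurableI; [exact: measurable_box|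
      apply: measurableI; apply: measurableC; exact: measurable_bid_le].
  move=> t /andP[t0 t1]; split; last first.
    by split => /=; rewrite bid_seg_point /bid /=; nra.
  by apply: forall_I2; rewrite bid_seg_point /bid /= -/L0 -/L1; nra.
- move=> j x [xL [/= /negP x0 /negP x1]]; move: j; apply: forall_I2.
  + apply: (strong_marginal_ge P1 P2 P3 Ps _ _ _ _ _ _ _ T0 _ _
      unif1 unif2 unif3) => //; first by left.
    by rewrite ltNge x0 xL.
  + apply: (strong_marginal_ge P1 P3 P2 Ps _ _ _ _ _ _ _ T1 _ _
      unif1 unif3 unif2) => //; first by right.
    by rewrite ltNge x1 xL.
Qed.
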